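(* Let $A,B$ be real symmetric $2\times2$ matrices and $F_H(x)=(\langle Ax,x\rangle,\langle Bx,x\rangle)$ for $x\in\mathbb{R}^2$. The following assertions are equivalent: (a) ND holds for $A$ and $B$; (b) $\ker A\cap\ker B=\{0\}$ and $F_H(\mathbb{R}^2)$ is a closed set different from a line.
   Context: ND (non-degenerate) holds for $A$ and $B$ if, for $u\in\mathbb{R}^2$, $\langle Au,u\rangle=0=\langle Bu,u\rangle$ implies $u=0$. A line is a (full) straight line, i.e. a one-dimensional affine subspace of $\mathbb{R}^2$. *)

(* Defs.v *)
From HB Require Import structures.
From mathcomp Require Import all_boot all_order all_algebra.
From mathcomp Require Import all_classical all_reals all_analysis.

Set Implicit Arguments.
Unset Strict Implicit.
Unset Printing Implicit Defensive.

Import Order.TTheory GRing.Theory Num.Theory.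
Import numFieldNormedType.Exports.

Local Open Scope classical_set_scope.
Local Open Scope ring_scope.

Definition inner (R : realType) (n : nat) (u v : 'cV[R]_n) : R :=
  \sum_i u i 0 * v i 0.

Definition non_degenerate (R : realType) (A B : 'M[R]_2) : Prop :=
  forall u : 'cV[R]_2,
    inner (A *m u) u = 0 -> inner (B *m u) u = 0 -> u = 0.

(* The kernel of u |-> A *m u on column vectors; MathComp's [kermx] is the
   kernel of the action on row vectors instead. *)
Definition ker_mx (R : realType) (n : nat) (A : 'M[R]_n) : set 'cV[R]_n :=
  [set u | A *m u = 0].

Definition quad_map (R : realType) (A B : 'M[R]_2) (x : 'cV[R]_2) : 'cV[R]_2 :=
  \col_(i < 2) (if i == 0 then inner (A *m x) x else inner (B *m x) x).

Definition is_line (R : realType) (L : set 'cV[R]_2) : Prop :=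
  exists p d : 'cV[R]_2, d != 0 /\ L = range (fun t : R => p + t *: d).

(* Main.v *)
(** Write F for the quadratic map and P for its polar map, so that
    F(su + tw) = s^2 F(u) + 2st P(u,w) + t^2 F(w).

    If ND holds, F is continuous, homogeneous of degree 2 and vanishes only at
    0, so |F(v)| >= m |v|^2 with m > 0 by compactness of the unit sphere; hence
    F is proper and its range is closed.  If the range were a line, it would be
    R d, and choosing F(u) = d, F(v) = -d the d-coordinate of F on span(u,v)
    would be an indefinite form, whose isotropic vectors contradict ND.

    If ND fails, take u <> 0 with F(u) = 0, w orthogonal to u, P = P(u,w) and
    Q = F(w).  The kernel condition gives P <> 0.  Since
    F(u/(2e) + e w) = P + e^2 Q tends to P, closedness puts P in the range, i.e.
    P = 2st P + t^2 Q with t <> 0; so Q is a multiple of P and the range is the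
    line R P. *)
Require Import Defs.
From HB Require Import structures.
From mathcomp Require Import all_boot all_order all_algebra.
From mathcomp Require Import all_classical all_reals all_analysis.
From mathcomp Require Import ring lra.

Set Implicit Arguments.
Unset Strict Implicit.
Unset Printing Implicit Defensive.

Import Order.TTheory GRing.Theory Num.Theory.
Import numFieldNormedType.Exports.

Local Open Scope classical_set_scope.
Local Open Scope ring_scope.

(** * Closed range of a definite map homogeneous of degree 2 *)

(** The domain consists of row vectors because [bounded_closed_compact] is stated for them. *)
Lemma closed_range_homogeneous (R : realType) (n : nat) (V : normedModType R)
    (f : 'rV[R]_n -> V) :
    continuous f -> (forall t v, f (t *: v) = t ^+ 2 *: f v) ->
    (forall v, f v = 0 -> v = 0) ->
  closed (range f).
Proof.
move=> fC fZ f0.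
have cpt r : compact [set v : 'rV[R]_n | `|v| <= r].
  apply: bounded_closed_compact.
    by exists r; split=> [|x rx v /= vr]; rewrite ?num_real //; lra.
  apply: (@closed_comp _ _ (fun v : 'rV[R]_n => `|v|) [set x | x <= r]).
    by move=> v _; exact: norm_continuous.
  exact: closed_le.
have [m m0 mP] : exists2 m : R, 0 < m & forall v, m * `|v| ^+ 2 <= `|f v|.
  pose S := [set v : 'rV[R]_n | `|v| = 1].
  have Sn (v : 'rV[R]_n) : v != 0 -> S (`|v|^-1 *: v).
    move=> v0; rewrite /S /= normrZ normfV normr_id mulVf //.
    by rewrite normr_eq0.
  (* The sphere is empty only when every vector is 0, as for [n = 0]; any positive [m] then
     works. *)
  have [S0|S0] := pselect (S !=set0); last first.
    exists 1 => // v; have [->|v0] := eqVneq v 0.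
      by rewrite normr0 expr0n mulr0.
    by exfalso; apply: S0; exists (`|v|^-1 *: v); exact: Sn.
  have cS : compact S.
    apply: (subclosed_compact _ (cpt 1)) => [|v /= ->//].
    apply: (@closed_comp _ _ (fun v : 'rV[R]_n => `|v|) [set x | x = 1]).
      by move=> v _; exact: norm_continuous.
    exact: closed_eq.
  have [|c] := @compact_EVT_min _ _ (fun v => `|f v|) S S0 cS.
    apply: continuous_subspaceT => v.
    by apply: continuous_comp; [exact: fC|exact: norm_continuous].
  rewrite inE /S /= => c1 cmin; exists `|f c|.
    rewrite normr_gt0; apply/negP => /eqP /f0 c0.
    by move: c1; rewrite c0 normr0 => /esym/eqP; rewrite oner_eq0.
  move=> v; have [->|v0] := eqVneq v 0.
    by rewrite normr0 expr0n mulr0.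
  have := cmin (`|v|^-1 *: v); rewrite inE => /(_ (Sn _ v0)).
  rewrite fZ normrZ normrX normfV normr_id exprVn mulrC.
  by rewrite ler_pdivlMr // exprn_gt0 // normr_gt0.
move=> y yf.
(* With c = (|y| + 1) / m, a value within 1 of y is attained only where |v|^2 <= c. Then |v| <= c +
   1, a bound that avoids square roots. *)
pose r := (`|y| + 1) / m + 1.
have clK : closed (f @` [set v | `|v| <= r]).
  apply: compact_closed; first exact: norm_hausdorff.
  by apply: continuous_compact (cpt r); exact: continuous_subspaceT.
suff [v _ <-] : (f @` [set v | `|v| <= r]) y by exists v.
(* Intersecting a neighbourhood of y with the unit ball around y confines the preimages to the
   compact ball of radius [r]. *)
apply: clK => U Uy.
have [_ [[v _ <-] [Ufv]]] := yf _ (filterI Uy (nbhsx_ballx y 1 ltr01)).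
rewrite -ball_normE /= => yfv; exists (f v); split=> //; exists v => //=.
have fv : `|f v| <= `|y| + 1.
  rewrite -(subrK y (f v)) addrC; apply: le_trans (ler_normD _ _) _.
  by rewrite lerD2l distrC ltW.
have : `|v| ^+ 2 <= (`|y| + 1) / m.
  by rewrite ler_pdivlMr // mulrC; exact: le_trans (mP v) fv.
have := normr_ge0 v; rewrite /r; nra.
Qed.

(** * Polarization and continuity of the quadratic map *)

Lemma symmetricmx_tr (R : fieldType) (n : nat) (M : 'M[R]_n) :
  M \is symmetricmx -> M^T = M.
Proof.
by move=> /is_hermitianmxP; rewrite expr0 scale1r map_mx_id => // <-.
Qed.

Definition polar_map (R : realType) (A B : 'M[R]_2) (u w : 'cV[R]_2) :
    'cV[R]_2 :=
  \col_(i < 2) (if i == 0 then inner (A *m u) w else inner (B *m u) w).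

Lemma inner_combination (R : realType) (n : nat) (M : 'M[R]_n) (s t : R)
    (u w : 'cV[R]_n) : M \is symmetricmx ->
  inner (M *m (s *: u + t *: w)) (s *: u + t *: w) =
  s ^+ 2 * inner (M *m u) u + 2 * s * t * inner (M *m u) w +
  t ^+ 2 * inner (M *m w) w.
Proof.
move=> /symmetricmx_tr Ms.
have innerE (x y : 'cV[R]_n) : inner x y = (x^T *m y) 0 0.
  by rewrite mxE; apply: eq_bigr => i _; rewrite mxE.
(* A 1x1 matrix equals its transpose, and [M] is symmetric. *)
have sym : inner (M *m w) u = inner (M *m u) w.
  by rewrite !innerE !trmx_mul Ms -[in RHS]mulmxA -[in RHS](trmxK (M *m w))
    -[in RHS]trmx_mul [in RHS]mxE trmx_mul Ms.
have -> : inner (M *m (s *: u + t *: w)) (s *: u + t *: w) =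
    s ^+ 2 * inner (M *m u) u + s * t * inner (M *m u) w +
    s * t * inner (M *m w) u + t ^+ 2 * inner (M *m w) w.
  rewrite mulmxDr -!scalemxAr /inner !mulr_sumr -!big_split /=.
  by apply: eq_bigr => i _; rewrite !mxE; ring.
by rewrite sym; ring.
Qed.

Lemma quad_map_combination (R : realType) (A B : 'M[R]_2) (s t : R)
    (u w : 'cV[R]_2) : A \is symmetricmx -> B \is symmetricmx ->
  quad_map A B (s *: u + t *: w) =
  s ^+ 2 *: quad_map A B u + (2 * s * t) *: polar_map A B u w +
  t ^+ 2 *: quad_map A B w.
Proof.
move=> As Bs; apply/matrixP => i j; rewrite !mxE.
by case: ifP => _; exact: inner_combination.
Qed.

Lemma quad_mapZ (R : realType) (A B : 'M[R]_2) (t : R) (u : 'cV[R]_2) :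
  quad_map A B (t *: u) = t ^+ 2 *: quad_map A B u.
Proof.
apply/matrixP => i j; rewrite !mxE; case: ifP => _;
  rewrite -!scalemxAr /inner mulr_sumr; apply: eq_bigr => k _;
  by rewrite !mxE; ring.
Qed.

Lemma quad_map_eq0 (R : realType) (A B : 'M[R]_2) (u : 'cV[R]_2) :
  quad_map A B u = 0 <-> inner (A *m u) u = 0 /\ inner (B *m u) u = 0.
Proof.
split=> [/colP F0|[A0 B0]]; last first.
  by apply/colP => i; rewrite !mxE A0 B0 if_same.
by have := F0 0; have := F0 1; rewrite !mxE.
Qed.

Lemma quad_map_continuous (R : realType) (A B : 'M[R]_2) :
  continuous (fun v : 'rV[R]_2 => quad_map A B v^T).
Proof.
(* An abstract domain is needed below: on matrices the neighbourhood filter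
   unfolds and its Filter instance is no longer found. *)
have sumC (T : topologicalType) (f : 'I_2 -> T -> R) :
    (forall i, continuous (f i)) -> continuous (fun x => \sum_i f i x).
  by move=> fC x; apply: (cvg_big add_continuous) => i _; exact: fC.
have mulC (T : topologicalType) (f g : T -> R) :
    continuous f -> continuous g -> continuous (fun x => f x * g x).
  by move=> fC gC x; apply: cvgM; [exact: fC|exact: gC].
have combC (T : topologicalType) (f g : T -> R) (a b : 'cV[R]_2) :
    continuous f -> continuous g -> continuous (fun x => f x *: a + g x *: b).
  by move=> fC gC x; apply: cvgD; apply: cvgZr_tmp; [exact: fC|exact: gC].
have innerC (M : 'M[R]_2) :
    continuous (fun v : 'rV[R]_2 => inner (M *m v^T) v^T).
  have -> : (fun v : 'rV[R]_2 => inner (M *m v^T) v^T) =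
      (fun v => \sum_i (\sum_j M i j * v 0 j) * v 0 i).
    apply/funext => v; apply: eq_bigr => i _; rewrite !mxE.
    by congr (_ * _); apply: eq_bigr => j _; rewrite mxE.
  have rowC i : continuous (fun v : 'rV[R]_2 => \sum_j M i j * v 0 j).
    apply: (sumC) => j.
    by apply: (mulC); [exact: cst_continuous|exact: coord_continuous].
  apply: (sumC) => i.
  by apply: (mulC); [exact: rowC|exact: coord_continuous].
have -> : (fun v : 'rV[R]_2 => quad_map A B v^T) =
    (fun v => inner (A *m v^T) v^T *: delta_mx 0 0 +
              inner (B *m v^T) v^T *: delta_mx 1 0).
  apply/funext => v; apply/matrixP => i j; rewrite !mxE ord1.
  by case: i => [[|[|//]] ?] /=; rewrite /= ?mulr0 ?mulr1 ?addr0 ?add0r.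
by apply: (combC); exact: innerC.
Qed.

(** * Nondegenerate pairs: the range is closed and is not a line *)

Lemma closed_range_quad_map (R : realType) (A B : 'M[R]_2) :
  non_degenerate A B -> closed (range (quad_map A B)).
Proof.
move=> nd.
have -> : range (quad_map A B) = range (fun v : 'rV[R]_2 => quad_map A B v^T).
  apply/seteqP; split=> [_ [u _ <-]|_ [v _ <-]]; last by exists v^T.
  by exists u^T; rewrite ?trmxK.
apply: closed_range_homogeneous => [|t v|v /quad_map_eq0[A0 B0]].
- exact: quad_map_continuous.
- by rewrite linearZ quad_mapZ.
- by rewrite -(trmxK v) (nd _ A0 B0) trmx0.
Qed.

Lemma range_quad_map_not_line (R : realType) (A B : 'M[R]_2) :
    A \is symmetricmx -> B \is symmetricmx -> non_degenerate A B ->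
  ~ is_line (range (quad_map A B)).
Proof.
move=> As Bs nd [p [d [d0 rE]]].
(* Since F(0) = 0, the line passes through the origin and is R d. *)
have [t0 _ t0E] : range (fun t : R => p + t *: d) 0.
  by rewrite -rE; exists 0 => //; rewrite -[X in quad_map _ _ X](scale0r 0)
    quad_mapZ expr0n scale0r.
have pE : p = - t0 *: d by rewrite scaleNr; apply/eqP; rewrite -addr_eq0 t0E.
have onto t : exists u, quad_map A B u = t *: d.
  have : range (fun t : R => p + t *: d) (t *: d).
    by exists (t + t0) => //; rewrite pE -scalerDl; congr (_ *: _); ring.
  by rewrite -rE => -[u _ uE]; exists u.
have [u uE] := onto 1; have [v vE] := onto (-1).
(* F(u + v) = d + 2 P(u,v) - d lies on the line, so P(u,v) is a multiple of d. *)
have [c cE] : exists c, polar_map A B u v = c *: d.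
  have [t _] : range (fun t : R => p + t *: d) (quad_map A B (1 *: u + 1 *: v)).
    by rewrite -rE; exists (1 *: u + 1 *: v).
  rewrite quad_map_combination // uE vE pE -scalerDl => tE.
  exists ((- t0 + t) / 2); rewrite mulrC -scalerA tE scaleN1r.
  by rewrite !expr1n !scale1r addrAC subrr add0r !mulr1 scalerA mulVf ?scale1r.
(* A root of s^2 + 2cs - 1, the coefficient of d in F(su + v). *)
pose s := - c + Num.sqrt (c ^+ 2 + 1).
have sE : s ^+ 2 + 2 * s * c - 1 = 0.
  have -> : s ^+ 2 + 2 * s * c - 1 = Num.sqrt (c ^+ 2 + 1) ^+ 2 - (c ^+ 2 + 1).
    by rewrite /s; ring.
  by rewrite sqr_sqrtr ?subrr // addr_ge0 ?sqr_ge0.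
have F0 : quad_map A B (s *: u + 1 *: v) = 0.
  rewrite quad_map_combination // uE vE cE !scalerA -!scalerDl.
  by rewrite -[RHS](scale0r d) -sE; congr (_ *: _); ring.
(* ND turns su + v into 0, so v = -su and -d = F(v) = s^2 d, which is impossible. *)
move/quad_map_eq0: F0 => [A0 B0]; have := nd _ A0 B0.
rewrite scale1r addrC => /eqP; rewrite addr_eq0 -scaleNr => /eqP v_u.
move: vE; rewrite v_u quad_mapZ uE scalerA => /eqP.
rewrite -subr_eq0 -scalerBl scaler_eq0 (negbTE d0) orbF => /eqP.
by have := sqr_ge0 s; lra.
Qed.

(** * Degenerate pairs: a closed range is a line *)

Lemma orthogonal_basis (R : realType) (u : 'cV[R]_2) : u != 0 ->
  exists w, (forall x, inner x u = 0 -> inner x w = 0 -> x = 0) /\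
            (forall v, exists s t, v = s *: u + t *: w).
Proof.
move=> u0.
have eq_cV2 (x y : 'cV[R]_2) : x 0 0 = y 0 0 -> x 1 0 = y 1 0 -> x = y.
  move=> e0 e1; apply/colP => i; case: (unliftP 0 i) => [j ->|-> //].
  by rewrite ord1 (_ : lift 0 0 = 1) //; exact: val_inj.
have N0 : u 0 0 ^+ 2 + u 1 0 ^+ 2 != 0.
  apply: contra u0; rewrite paddr_eq0 ?sqr_ge0 // !sqrf_eq0.
  by move=> /andP[/eqP u00 /eqP u10]; apply/eqP/eq_cV2; rewrite mxE.
(* [w] is [u] rotated by a quarter turn, so it is orthogonal to [u] and has the same length. *)
exists (\col_(i < 2) if i == 0 then - u 1 0 else u 0 0); split=> [x|v].
  have -> : inner x u = x 0 0 * u 0 0 + x 1 0 * u 1 0.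
    rewrite /inner big_ord_recl big_ord1 (_ : lift _ _ = 1) //.
    exact: val_inj.
  rewrite /inner big_ord_recl big_ord1 (_ : lift _ _ = 1); last exact: val_inj.
  rewrite !mxE /=; set p := (X in X = 0 -> _); set q := (X in _ -> X = 0 -> _).
  (* Each coordinate of x times |u|^2 is a combination of p = <x,u> and q = <x,w>. *)
  move=> p0 q0; apply: eq_cV2; rewrite mxE; apply: (mulIf N0); rewrite mul0r.
    transitivity (u 0 0 * p - u 1 0 * q); first by rewrite /p /q; ring.
    by rewrite p0 q0 !mulr0 subr0.
  transitivity (u 1 0 * p + u 0 0 * q); first by rewrite /p /q; ring.
  by rewrite p0 q0 !mulr0 addr0.
(* The coefficients are the projections <v,u> / |u|^2 and <v,w> / |w|^2. *)
exists ((v 0 0 * u 0 0 + v 1 0 * u 1 0) / (u 0 0 ^+ 2 + u 1 0 ^+ 2)).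
exists ((- v 0 0 * u 1 0 + v 1 0 * u 0 0) / (u 0 0 ^+ 2 + u 1 0 ^+ 2)).
by apply: eq_cV2; rewrite !mxE /=; field.
Qed.

Lemma closed_range_null_vector (R : realType) (A B : 'M[R]_2) (u w : 'cV[R]_2) :
    A \is symmetricmx -> B \is symmetricmx -> quad_map A B u = 0 ->
  closed (range (quad_map A B)) -> range (quad_map A B) (polar_map A B u w).
Proof.
move=> As Bs u0 cl.
pose P := polar_map A B u w; pose Q := quad_map A B w.
(* The limit is taken over e <> 0 because the preimage of P + e^2 Q involves 1 / (2e). *)
apply: (@closed_cvg _ _ (0 : R)^' _ (fun e : R => P + e ^+ 2 *: Q)) => //.
  near=> e.
  have e0 : e != 0 by near: e; exact: nbhs_dnbhs_neq.
  exists ((2 * e)^-1 *: u + e *: w) => //.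
  rewrite quad_map_combination // u0 scaler0 add0r -/P -/Q.
  by congr (_ + _); rewrite -[RHS]scale1r; congr (_ *: _); field.
have lim : (fun e : R => P + e ^+ 2 *: Q) @ (0 : R)^' --> P + 0 ^+ 2 *: Q.
  apply: cvgD; first exact: cvg_cst.
  apply: cvgZ; last exact: cvg_cst.
  by apply: cvg_within_filter; exact: exprn_continuous.
by rewrite expr0n scale0r addr0 in lim.
Unshelve. all: by end_near.
Qed.

Lemma quad_map_range_line (R : realType) (A B : 'M[R]_2) :
    A \is symmetricmx -> B \is symmetricmx ->
    ker_mx A `&` ker_mx B = [set 0] -> closed (range (quad_map A B)) ->
    ~ non_degenerate A B ->
  is_line (range (quad_map A B)).
Proof.
move=> As Bs kerAB cl nd.
have [u [F0 u0]] : exists u, quad_map A B u = 0 /\ u != 0.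
  apply: contra_notP nd => nex u Au Bu; apply/eqP/negPn/negP => u0; apply: nex.
  by exists u; split=> //; apply/quad_map_eq0.
have [w [perp span]] := orthogonal_basis u0.
pose P := polar_map A B u w; pose Q := quad_map A B w.
have FE s t : quad_map A B (s *: u + t *: w) = (2 * s * t) *: P + t ^+ 2 *: Q.
  by rewrite quad_map_combination // F0 scaler0 add0r.
(* If P = 0, then Au and Bu are orthogonal to both [u] and [w], hence zero, and the kernel condition
   forces u = 0. *)
have P0 : P != 0.
  apply: contra u0 => /eqP/colP P0; have [A0 B0] := (quad_map_eq0 A B u).1 F0.
  have : (ker_mx A `&` ker_mx B) u.
    split; apply: perp => //; [have := P0 0|have := P0 1]; by rewrite !mxE.
  by rewrite kerAB => ->.
have [k QE] : exists k, Q = k *: P.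
  have [v _] := closed_range_null_vector w As Bs F0 cl; rewrite -/P.
  have [s [t ->]] := span v; rewrite FE.
  (* For t = 0 the equation reads P = 0; otherwise P = 2st P + t^2 Q can be solved for Q. *)
  have [->|t0 e] := eqVneq t 0.
    by rewrite mulr0 expr0n !scale0r addr0 => /esym/eqP; rewrite (negbTE P0).
  exists ((t ^+ 2)^-1 * (1 - 2 * s * t)).
  rewrite -scalerA scalerBl scale1r -[X in X - _]e addrAC subrr add0r.
  by rewrite scalerA mulVf ?scale1r // expf_neq0.
exists 0, P; split=> //; apply/seteqP; split=> [_ [v _ <-]|_ [r _ <-]].
  have [s [t ->]] := span v; exists (2 * s * t + t ^+ 2 * k) => //.
  by rewrite FE QE scalerA -scalerDl add0r.
(* With t = 1 the coefficient of P is 2s + k, which takes every real value. *)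
exists (((r - k) / 2) *: u + 1 *: w) => //.
by rewrite FE QE scalerA -scalerDl add0r; congr (_ *: _); field.
Qed.

Theorem theorem3p6 (R : realType) (A B : 'M[R]_2)
    (hA : A \is symmetricmx) (hB : B \is symmetricmx) :
  non_degenerate A B <->
  (ker_mx A `&` ker_mx B = [set 0] /\
   closed (range (quad_map A B)) /\
   ~ is_line (range (quad_map A B))).
Proof.
split=> [nd|[kerAB [cl nl]]].
  split; last first.
    by split; [exact: closed_range_quad_map|exact: range_quad_map_not_line].
  apply/seteqP; split=> [u [/= Au Bu]|_ ->]; last first.
    by split; rewrite /ker_mx /= mulmx0.
  by apply: nd; rewrite ?Au ?Bu /inner big1 // => i _; rewrite mxE mul0r.
by apply: contra_notP nl; exact: quad_map_range_line.
Qed.
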